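(* Let $\mathcal H$ be a separable Hilbert space and let $S:\mathcal H\to\mathcal H$ be a bounded, self-adjoint, positive definite operator (with bounded inverse $S^{-1}$). Let $S_1,S_2:\mathcal H\to\mathcal H$ be bounded, self-adjoint and positive semidefinite with $S=S_1+S_2$. Then for any $\lambda\in\mathbb R$, $$\left(\lambda-\frac{\lambda^2}{4}\right) S_1+\left(1-\frac{\lambda^2}{4}\right) S_2\le S_2+S_1S^{-1}S_1=S_1+S_2S^{-1}S_2\le S.$$
   Context: For operators $U,V:\mathcal H\to\mathcal H$, write $U\le V$ if $U,V$ are self-adjoint and $V-U$ is positive semidefinite, i.e. $\langle (V-U)f,f\rangle\ge 0$ for all $f\in\mathcal H$. Positive definite operators are understood to be boundedly invertible. Hilbert spaces are complex. *)

(* Defs.v *)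
From HB Require Import structures.
From mathcomp Require Import all_boot all_order all_algebra sesquilinear.
From mathcomp Require Import complex.
From mathcomp Require Import all_classical all_reals all_analysis.

Set Implicit Arguments.
Unset Strict Implicit.
Unset Printing Implicit Defensive.

Import Order.TTheory GRing.Theory Num.Theory.
Import numFieldNormedType.Exports.

Local Open Scope classical_set_scope.
Local Open Scope complex_scope.
Local Open Scope ring_scope.

(* [inner] is linear in its first argument and conjugate-linear in its second.
   The norm of a normed module over R[i] takes its values in R[i]. *)
HB.mixin Record NormedModule_isHilbert (R : realType) (H : Type)
    & CompleteNormedModule R[i] H := {
  inner : {dot H for (@Num.conj R[i])} ;
  normr_inner : forall f : H, `|f| ^+ 2 = inner f f
}.

#[short(type="hilbertType")]
HB.structure Definition Hilbert (R : realType) :=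
  {H of CompleteNormedModule R[i] H & NormedModule_isHilbert R H}.

Notation "''[' f , g ]" := (inner f g)
  (format "''[' f ,  g ]") : ring_scope.

Definition separable_space (T : topologicalType) : Prop :=
  exists2 D : set T, countable D & dense D.

Section Operators.
Variables (R : realType) (H : hilbertType R).
Implicit Types A B U V : {linear H -> H}.

Definition bounded_op A : Prop :=
  exists M : R, forall f : H, `|A f| <= M%:C * `|f|.

Definition self_adjoint A : Prop := forall f g : H, '[A f, g] = '[f, A g].

(* In the order of R[i], [0 <= z] says that [z] is real and nonnegative. *)
Definition pos_semidef A : Prop := forall f : H, 0 <= '[A f, f].

Definition bounded_inverse A B : Prop :=
  [/\ bounded_op B, cancel A B & cancel B A].

(* By convention a positive definite operator is boundedly invertible. *)
Definition pos_def A : Prop :=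
  (forall f : H, f != 0 -> 0 < '[A f, f]) /\ exists B, bounded_inverse A B.

Definition op_le U V : Prop :=
  [/\ self_adjoint U, self_adjoint V & pos_semidef (V \- U)].

End Operators.

(* Main.v *)
Require Import Defs.
From HB Require Import structures.
From mathcomp Require Import all_boot all_order all_algebra sesquilinear.
From mathcomp Require Import complex ring.
From mathcomp Require Import all_classical all_reals all_analysis.

Set Implicit Arguments.
Unset Strict Implicit.
Unset Printing Implicit Defensive.

Import Order.TTheory GRing.Theory Num.Theory.
Import numFieldNormedType.Exports.

Local Open Scope classical_set_scope.
Local Open Scope complex_scope.
Local Open Scope ring_scope.


(** The inequalities are two facts about quadratic forms. Fix [f] and split it
    as [f = g + h] with [h = S^-1 S1 f] and [g = S^-1 S2 f], so that
    [S h = S1 f] and [S g = S2 f].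

    The lower bound is the positivity of the form of [S] at [h - t f]: since
    [S h = S1 f], this form expands to
    [<S1 S^-1 S1 f, f> - 2 t <S1 f, f> + t^2 <S f, f>], and for [t = lambda / 2]
    it is the difference of the two sides, as [S = S1 + S2].

    For the upper bound, [S1 g = S2 f - S2 g = S2 h]: the vectors [g] and [h]
    balance [S1] against [S2], as currents do in two parallel resistors. The
    difference [<S2 f, f> - <S2 S^-1 S2 f, f> = <S2 h, g + h>] is therefore
    [<S1 g, g> + <S2 h, h>], a sum of two nonnegative terms.

    The middle equality comes from the same balance [S1 g = S2 h], which says
    that [S1 S^-1 S2 = S2 S^-1 S1]. *)

Section SelfAdjoint.
Variables (R : realType) (H : hilbertType R).
Implicit Types A B : {linear H -> H}.

Lemma self_adjointD A B :
  self_adjoint A -> self_adjoint B -> self_adjoint (A \+ B).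
Proof. by move=> saA saB f g; rewrite /= linearDl linearDr /= saA saB. Qed.

Lemma innerZr_real (a : R) (f g : H) : '[f, a%:C *: g] = a%:C * '[f, g].
Proof. by rewrite linearZr /= conj_Creal //; apply/CrealP/conjc_real. Qed.

Lemma self_adjointZ (a : R) A :
  self_adjoint A -> self_adjoint (a%:C \*: A).
Proof. by move=> saA f g; rewrite /= innerZr_real linearZl_LR /= saA. Qed.

Lemma self_adjoint_inverse A B :
  self_adjoint A -> bounded_inverse A B -> self_adjoint B.
Proof. by move=> saA [_ _ BK] f g; rewrite -{1}[g]BK -saA BK. Qed.

Lemma self_adjoint_sandwich A B :
  self_adjoint A -> self_adjoint B -> self_adjoint (A \o B \o A).
Proof. by move=> saA saB f g; rewrite /= saA saB saA. Qed.

End SelfAdjoint.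

Section Splitting.
Variables (R : realType) (H : hilbertType R).
Variables (S Sinv S1 S2 : {linear H -> H}).
Hypothesis SinvK : cancel Sinv S.
Hypothesis SK : cancel S Sinv.
Hypothesis splitS : S = S1 \+ S2 :> (H -> H).

Let SE f : S f = S1 f + S2 f. Proof. by rewrite splitS. Qed.

Lemma splitting_sum f : Sinv (S1 f) + Sinv (S2 f) = f.
Proof. by rewrite -linearD /= -SE SK. Qed.

(** Write [g = S^-1 S2 f] and [h = S^-1 S1 f], so that [g + h = f]: adding
    [S2 g] to both sides gives [S g = S2 f] on the left and [S2 (g + h)] on the
    right. *)
Lemma splitting_balance f : S1 (Sinv (S2 f)) = S2 (Sinv (S1 f)).
Proof.
apply: (addIr (S2 (Sinv (S2 f)))).
by rewrite -SE SinvK -linearD /= splitting_sum.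
Qed.

(** The two sides are [S - S1 S^-1 S2] and [S - S2 S^-1 S1], which agree by the
    balance relation. *)
Lemma splitting_eq :
  S2 \+ (S1 \o Sinv \o S1) = S1 \+ (S2 \o Sinv \o S2) :> (H -> H).
Proof.
apply/funext => f /=.
apply: (addIr (S1 (Sinv (S2 f)))).
rewrite -addrA -linearD /= splitting_sum splitting_balance.
by rewrite -addrA -linearD /= [Sinv _ + _]addrC splitting_sum addrC.
Qed.

Hypothesis saS1 : self_adjoint S1.
Hypothesis saS2 : self_adjoint S2.
Hypothesis psdS1 : pos_semidef S1.
Hypothesis psdS2 : pos_semidef S2.

Let saS : self_adjoint S.
Proof. by move=> f g; rewrite !SE linearDl linearDr /= saS1 saS2. Qed.

Let psdS : pos_semidef S.
Proof. by move=> f; rewrite SE linearDl addr_ge0 ?psdS1 ?psdS2. Qed.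

(** The expression is the form of [S] at [S^-1 S1 f - t f]. *)
Lemma completed_square_ge0 (t : R) f :
  0 <= '[S1 (Sinv (S1 f)), f] - 2 * t%:C * '[S1 f, f] + t%:C ^+ 2 * '[S f, f].
Proof.
have := psdS (Sinv (S1 f) - t%:C *: f); set h := Sinv _.
have Sh : S h = S1 f by rewrite /h SinvK.
rewrite [S _]linearB [S (_ *: _)]linearZ /= Sh linearBl !linearBr /=.
rewrite !innerZr_real !linearZl_LR /= -/h.
have -> : '[S f, h] = '[S1 f, f] by rewrite saS Sh saS1.
have -> : '[S1 f, h] = '[S1 h, f] by rewrite -Sh saS Sh saS1.
by congr (0 <= _); ring.
Qed.

(** With [h = S^-1 S1 f] and [g = S^-1 S2 f], the left side is [<S2 h, f>], since
    [f - g = h]. Splitting [f] there as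
    [g + h] leaves the cross term [<S2 h, g>], which the balance relation turns
    into [<S1 g, g>]. *)
Lemma splitting_gap f :
  '[S f, f] - '[S1 f + S2 (Sinv (S2 f)), f] =
  '[S1 (Sinv (S2 f)), Sinv (S2 f)] + '[S2 (Sinv (S1 f)), Sinv (S1 f)].
Proof.
have [fE bal] := (splitting_sum f, splitting_balance f).
move: (Sinv (S1 f)) (Sinv (S2 f)) fE bal => h g fE bal.
rewrite -linearBl /= SE opprD addrACA subrr add0r -linearB /=.
rewrite -{1}fE addrK -{1}fE linearDr /= addrC; congr (_ + _).
by rewrite bal.
Qed.

End Splitting.

Theorem theorem2p2 (R : realType) (H : hilbertType R) (S Sinv S1 S2 : {linear H -> H}) :
  separable_space H ->
  bounded_op S -> self_adjoint S -> pos_def S ->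
  bounded_inverse S Sinv ->
  bounded_op S1 -> self_adjoint S1 -> pos_semidef S1 ->
  bounded_op S2 -> self_adjoint S2 -> pos_semidef S2 ->
  S = S1 \+ S2 :> (H -> H) ->
  forall lambda : R,
    [/\ op_le ((lambda - lambda ^+ 2 / 4)%:C \*: S1
                 \+ (1 - lambda ^+ 2 / 4)%:C \*: S2)
              (S2 \+ (S1 \o Sinv \o S1)),
        S2 \+ (S1 \o Sinv \o S1) = S1 \+ (S2 \o Sinv \o S2) :> (H -> H)
      & op_le (S1 \+ (S2 \o Sinv \o S2)) S].
Proof.
move=> _ _ saS _ invS _ saS1 psdS1 _ saS2 psdS2 splitS lambda.
have [_ SK SinvK] := invS.
have saSinv := self_adjoint_inverse saS invS.
split; last 1 first.
- split=> //; first exact/self_adjointD/self_adjoint_sandwich.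
  move=> f; rewrite /= linearBl /= (splitting_gap SinvK SK splitS).
  by rewrite addr_ge0 ?psdS1 ?psdS2.
- split; [exact/self_adjointD/self_adjointZ/saS2/self_adjointZ
         |exact/self_adjointD/self_adjoint_sandwich|].
  move=> f.
  (* [t = lambda / 2] turns the term [- 2 t S1] into [- lambda S1]. *)
  have := completed_square_ge0 SinvK splitS saS1 saS2 psdS1 psdS2 (lambda / 2) f.
  rewrite splitS /= linearBl !linearDl /= !linearZl_LR /=.
  rewrite !(rmorphB, rmorphM, rmorphXn, fmorphV, rmorph1, rmorph_nat) /=.
  by congr (0 <= _); field.
- exact: splitting_eq.
Qed.
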